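(* Let $\alpha, A, B$ be real numbers with $0<\alpha<1$ and $0<A\le B$. Choose an integer $m>2/\alpha$, define $$C_m:=\frac{m}{64}\left(\frac94\right)^{1/m},$$ and set $$\varepsilon_{\alpha,A,m}:=\min\left\{2^{-m-1},\ \left(\frac{A}{C_m}\right)^{1/(\alpha-2/m)},\ \left(\frac{A}{m}\right)^{1/\alpha}\right\}.$$ Then, for every real $\varepsilon$ with $0<\varepsilon\le\varepsilon_{\alpha,A,m}$ and every integer $d$ satisfying $$A\varepsilon^{-\alpha}\le d\le B\varepsilon^{-\alpha},$$ one has $$n^{\ast}(d,\varepsilon)\ge\frac{1}{8B\,64^m}\,d\,\varepsilon^{-(2-\alpha)}.$$
   Context: Here $\mathbb{N}=\{1,2,3,\dots\}$. For $d\in\mathbb{N}$ and $y=(y_1,\dots,y_d)\in[0,1]^d$, write $[0,y):=\prod_{j=1}^d[0,y_j)$, let $\mathbf{1}_{[0,y)}$ be its indicator function and $\operatorname{vol}([0,y))=\prod_{j=1}^d y_j$ its Lebesgue measure. For an $N$-point multiset $P=\{x_1,\dots,x_N\}\subset[0,1)^d$ (points may be repeated and are counted with multiplicity), the star discrepancy is $$D_N^{\ast}(P):=\sup_{y\in[0,1]^d}\left|\frac1N\sum_{n=1}^N\mathbf{1}_{[0,y)}(x_n)-\operatorname{vol}([0,y))\right|.$$ The minimal star discrepancy is $D^{\ast}(N,d):=\inf_{P\subset[0,1)^d,\ |P|=N}D_N^{\ast}(P)$, the infimum being over all $N$-point multisets, and the inverse of the star discrepancy is $$n^{\ast}(d,\varepsilon):=\min\{N\in\mathbb{N}: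 D^{\ast}(N,d)\le\varepsilon\}.$$ *)

(* Defs.v *)
From HB Require Import structures.
From mathcomp Require Import all_boot all_order all_algebra.
From mathcomp Require Import all_classical all_reals all_analysis.
Set Implicit Arguments.
Unset Strict Implicit.
Unset Printing Implicit Defensive.
Import Order.TTheory GRing.Theory Num.Theory.
Local Open Scope classical_set_scope.
Local Open Scope ring_scope.

Definition closed_cube (R : realType) (d : nat) : set 'rV[R]_d :=
  [set y | forall j, 0 <= y 0 j <= 1].

Definition half_open_cube (R : realType) (d : nat) : set 'rV[R]_d :=
  [set x | forall j, 0 <= x 0 j < 1].

Definition anchored_box (R : realType) (d : nat) (y : 'rV[R]_d) :
  set 'rV[R]_d := [set x | forall j, 0 <= x 0 j < y 0 j].

Definition box_vol (R : realType) (d : nat) (y : 'rV[R]_d) : R :=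
  \prod_(j < d) y 0 j.

(* An [N]-point multiset is an ['I_N]-indexed family, so repeated points are
   counted with multiplicity. *)
Definition star_discrepancy (R : realType) (d N : nat)
    (P : 'I_N -> 'rV[R]_d) : R :=
  sup [set `|N%:R^-1 * (\sum_(n < N) \1_(anchored_box y) (P n)) - box_vol y|
      | y in @closed_cube R d].

Definition min_star_discrepancy (R : realType) (N d : nat) : R :=
  inf [set star_discrepancy P
      | P in [set P : 'I_N -> 'rV[R]_d | forall n, half_open_cube (P n)]].

Definition is_least (S : set nat) (n : nat) : Prop :=
  S n /\ forall k, S k -> (n <= k)%N.

(* The default value 0 would only be taken if no positive [N] satisfied the
   condition; being 0, it cannot make a positive lower bound true. *)
Definition inverse_star_discrepancy (R : realType) (d : nat) (eps : R) : nat :=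
  xget 0%N
    (is_least [set N | (0 < N)%N /\ min_star_discrepancy R N d <= eps]).

Definition C_const (R : realType) (m : nat) : R :=
  m%:R / 64 * (9 / 4) `^ (m%:R^-1).

Definition eps_threshold (R : realType) (alpha A : R) (m : nat) : R :=
  Num.min (2 ^- m.+1)
    (Num.min ((A / C_const R m) `^ (alpha - 2 / m%:R)^-1)
             ((A / m%:R) `^ alpha^-1)).

(* Main.v *)
(* If [P] has star discrepancy at most [eps], then for an [m]-subset [S] of the
   coordinates the tensor product over [S] of [3 * 1_{x_j < 1/3} - 1] is a
   combination of indicators of anchored boxes.  So is the product of two such
   functions; its coefficients have absolute sum at most [16 ^ m], and its
   integral vanishes when the two subsets differ.  The Gram matrix of these
   ['C(d, m)] functions over the points of [P] is therefore close to
   [2 ^ m] times the identity, yet has rank at most [N]; comparing its trace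
   with its Frobenius norm forces [N >= 1 / (8 * 64 ^ m * eps ^ 2)] as soon as
   ['C(d, m) >= (d / m) ^ m] exceeds a multiple of [eps ^ -2], which the choice
   of [m > 2 / alpha] ensures.  That the inverse star discrepancy is attained at
   all follows from a regular grid. *)
Require Import Defs.
From mathcomp Require Import all_boot all_order all_algebra.
From mathcomp Require Import all_classical all_reals all_analysis.
From mathcomp Require Import ring lra.
Import Order.TTheory GRing.Theory Num.Theory.
Local Open Scope ring_scope.

(** * Trace against Frobenius norm of a Gram matrix *)

Lemma sqr_sum_le_card (R : realFieldType) (N : nat) (a : 'I_N -> R) :
  (\sum_n a n) ^+ 2 <= N%:R * \sum_n a n ^+ 2.
Proof.
have : 0 <= \sum_i \sum_j (a i - a j) ^+ 2.
  by do 2![apply: sumr_ge0 => ? _]; exact: sqr_ge0.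
have -> : \sum_i \sum_j (a i - a j) ^+ 2 =
    \sum_i (N%:R * a i ^+ 2 + \sum_j a j ^+ 2 - 2 * (a i * \sum_j a j)).
  apply: eq_bigr => i _.
  rewrite !mulr_sumr.
  have -> : N%:R * a i ^+ 2 = \sum_(j < N) a i ^+ 2.
    by rewrite sumr_const card_ord mulr_natl.
  rewrite -big_split -sumrB /=; apply: eq_bigr => j _; ring.
rewrite !big_split /= -mulr_sumr sumr_const card_ord -mulr_natl sumrN.
rewrite -mulr_sumr -mulr_suml; lra.
Qed.

(* The Gram matrices of the rows and of the columns of [F] have the same trace
   and the same Frobenius norm. *)
Lemma sqr_trace_gram_le (R : realFieldType) (I : finType) (Q : {pred I})
    (N : nat) (F : I -> 'I_N -> R) :
  (\sum_(S in Q) \sum_n F S n ^+ 2) ^+ 2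
    <= N%:R * \sum_(S in Q) \sum_(T in Q) (\sum_n F S n * F T n) ^+ 2.
Proof.
have -> : \sum_(S in Q) \sum_(T in Q) (\sum_n F S n * F T n) ^+ 2 =
    \sum_n \sum_k (\sum_(S in Q) F S n * F S k) ^+ 2.
  transitivity (\sum_(S in Q) \sum_(T in Q) \sum_n \sum_k
      (F S n * F T n) * (F S k * F T k)).
    apply: eq_bigr => S _; apply: eq_bigr => T _.
    by rewrite expr2 mulr_suml; apply: eq_bigr => n _; rewrite mulr_sumr.
  transitivity (\sum_n \sum_k \sum_(S in Q) \sum_(T in Q)
      (F S n * F T n) * (F S k * F T k)).
    under eq_bigr do rewrite exchange_big /=.
    rewrite exchange_big; apply: eq_bigr => n _ /=.
    under eq_bigr do rewrite exchange_big /=.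
    by rewrite exchange_big.
  apply: eq_bigr => n _; apply: eq_bigr => k _.
  rewrite expr2 mulr_suml; apply: eq_bigr => S _; rewrite mulr_sumr.
  by apply: eq_bigr => T _; rewrite mulrACA.
(* Cauchy-Schwarz runs over the [N] diagonal entries of the column Gram matrix, hence the factor
   [N]; its off-diagonal squares are then dropped. *)
rewrite exchange_big /=; apply: le_trans (sqr_sum_le_card _ _ _) _.
apply: ler_wpM2l => //; apply: ler_sum => n _.
rewrite (bigD1 n) //= -[leLHS]addr0 lerD //.
by apply: sumr_ge0 => ? _; exact: sqr_ge0.
Qed.

(** * Tensor-product tests built from anchored boxes *)

Section TestBoxes.
Context (R : realType) (d N : nat) (P : 'I_N -> 'rV[R]_d) (e : R).
Context (cubeP : forall n, half_open_cube (P n)).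
Context (discP : forall y, closed_cube y ->
  `|N%:R^-1 * (\sum_n \1_(anchored_box y) (P n)) - box_vol y| <= e).

(** Expanding the product over subsets [T] gives boxes with side [1/3] on [T] and [1] elsewhere.
    Each costs at most [e] times the absolute value of its coefficient, and these values sum to the
    product on the right. *)
Lemma mean_prod_affine (a b : 'I_d -> R) :
  `|N%:R^-1 * (\sum_n \prod_j (b j * (P n 0 j < 3^-1)%R%:R + a j))
      - \prod_j (b j / 3 + a j)| <= e * \prod_j (`|b j| + `|a j|).
Proof.
pose corner (T : {set 'I_d}) : 'rV[R]_d :=
  \row_j (if j \in T then 3^-1 else 1).
pose c (T : {set 'I_d}) := \prod_j (if j \in T then b j else a j).
have third : 0 <= (3^-1 : R) <= 1 by apply/andP; split; lra.
have cornerP T : closed_cube (corner T).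
  by move=> j; rewrite mxE; case: ifP; rewrite ?third ?ler01 ?lexx.
have prodE n : \prod_j (b j * (P n 0 j < 3^-1)%R%:R + a j) =
    \sum_(T in {set 'I_d}) c T * \1_(anchored_box (corner T)) (P n).
  rewrite bigA_distr; apply: eq_bigr => T _.
  have -> : \1_(anchored_box (corner T)) (P n) =
      \prod_j (if j \in T then (P n 0 j < 3^-1)%R%:R else 1) :> R.
    rewrite indicE; have [h|h] := boolP (P n \in anchored_box (corner T)).
      move: h; rewrite inE => h; rewrite big1// => j _.
      by case: ifP => // jT; have := h j; rewrite mxE jT => /andP[_ ->].
    (* At sides equal to [1] the strict bound comes from the half-open cube. *)
    apply/esym/eqP; apply: contraNT h => h; rewrite inE => j.
    have /andP[-> P1] := cubeP n j; rewrite mxE.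
    move/prodf_neq0 : h => /(_ j isT); case: ifP => //=.
    by case: (P n 0 j < 3^-1) => //=; rewrite eqxx.
  by rewrite -big_split /=; apply: eq_bigr => j _; case: ifP; rewrite ?mulr1.
have volE : \prod_j (b j / 3 + a j) =
    \sum_(T in {set 'I_d}) c T * box_vol (corner T).
  rewrite bigA_distr; apply: eq_bigr => T _.
  rewrite -big_split /=; apply: eq_bigr => j _.
  by rewrite mxE; case: ifP; rewrite ?mulr1.
rewrite (eq_bigr _ (fun n _ => prodE n)).
rewrite exchange_big /= mulr_sumr volE -sumrB bigA_distr mulr_sumr.
apply: le_trans (ler_norm_sum _ _ _) _; apply: ler_sum => T _.
rewrite -mulr_sumr mulrCA -mulrBr normrM mulrC.
have -> : \prod_j (if j \in T then `|b j| else `|a j|) = `|c T|.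
  by rewrite normr_prod; apply: eq_bigr => j _; case: ifP.
by apply: ler_wpM2r => //; exact: discP.
Qed.

(* Centred at threshold [1/3], where the squared ratio [(1 + p)^2 / (p (1 - p))]
   of coefficient norm to standard deviation is smallest. *)
Definition tensor_test (S : {set 'I_d}) (n : 'I_N) : R :=
  \prod_j (if j \in S then 3 * (P n 0 j < 3^-1)%R%:R - 1 else 1).

Let corr (S T : {set 'I_d}) : R :=
  N%:R^-1 * \sum_n tensor_test S n * tensor_test T n.

(** For [x] in [{0, 1}], [(3x - 1)^2 = 3x + 1], so the product of two tests is again a product of
    affine factors: mean [2] on the intersection, [0] on the symmetric difference, coefficient norm
    [4] on both. *)
Lemma tensor_test_corr (S T : {set 'I_d}) :
  `|corr S T - (if S == T then 2 ^+ #|S| else 0)| <= e * 4 ^+ #|S :|: T|.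
Proof.
pose b j : R := if j \in S :|: T then 3 else 0.
pose a j : R := if (j \in S) (+) (j \in T) then -1 else 1.
have -> : corr S T =
    N%:R^-1 * (\sum_n \prod_j (b j * (P n 0 j < 3^-1)%R%:R + a j)).
  congr (_ * _); apply: eq_bigr => n _; rewrite -big_split /=.
  apply: eq_bigr => j _; rewrite /a /b inE.
  by case: (j \in S); case: (j \in T); case: (_ < _) => /=; ring.
have -> : 4 ^+ #|S :|: T| = \prod_j (`|b j| + `|a j|).
  rewrite -prodr_const [LHS]big_mkcond; apply: eq_bigr => j _.
  rewrite /b /a; case: ifP => [|/negbT].
    by case: (_ (+) _) => _; rewrite ?normrN normr1 ger0_norm; lra.
  by rewrite inE negb_or => /andP[/negPf-> /negPf->] /=; rewrite normr0 normr1 add0r.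
have -> : (if S == T then 2 ^+ #|S| else 0) = \prod_j (b j / 3 + a j).
  have [eqST|neqST] := eqVneq S T.
    rewrite -prodr_const [LHS]big_mkcond; apply: eq_bigr => j _.
    by rewrite /b /a -eqST finset.setUid addbb; case: ifP => _; lra.
  have [j jST] : exists j, (j \in S) (+) (j \in T).
    apply/existsP; apply: contraNT neqST; rewrite negb_exists => /forallP h.
    by apply/eqP/setP => j; move: (h j); do 2!case: (_ \in _).
  rewrite (bigD1 j) //= /a /b jST inE.
  have -> : (j \in S) || (j \in T) by move: jST; do 2!case: (_ \in _).
  by rewrite [X in X * _](_ : _ = 0) ?mul0r //; lra.
exact: mean_prod_affine.
Qed.

(** Trace against Frobenius norm for the tests of the [m]-subsets; two of them have a union of at
    most [2m] elements, whence [16 ^ m]. The condition on [e] keeps the lower bound for the trace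
    nonnegative, so that it can be squared. *)
Lemma binomial_points_ineq (m : nat) : (0 < N)%N -> 4 ^+ m * e <= 2 ^+ m ->
  'C(d, m)%:R ^+ 2 * (2 ^+ m - 4 ^+ m * e) ^+ 2 <=
  N%:R * ('C(d, m)%:R * (2 ^+ m + 4 ^+ m * e) ^+ 2
          + 'C(d, m)%:R ^+ 2 * (16 ^+ m * e) ^+ 2).
Proof.
move=> N0 em; set n := 'C(d, m).
pose Q : {set {set 'I_d}} := [set S : {set 'I_d} | #|S| == m].
have cardQ : #|Q| = n by rewrite card_draws card_ord.
have e0 : 0 <= e.
  apply: le_trans (discP (const_mx 1) _); first exact: normr_ge0.
  by move=> j; rewrite mxE ler01 lexx.
have NR0 : (0 : R) < N%:R by rewrite ltr0n.
have sumE S T : \sum_n tensor_test S n * tensor_test T n = N%:R * corr S T.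
  by rewrite /corr mulrA divff ?mul1r ?gt_eqF.
have diag S : S \in Q ->
    2 ^+ m - 4 ^+ m * e <= corr S S <= 2 ^+ m + 4 ^+ m * e.
  rewrite inE => /eqP cS; have := tensor_test_corr S S.
  by rewrite eqxx finset.setUid cS ler_distl (mulrC e).
have offdiag S T : S \in Q -> T \in Q -> S != T ->
    corr S T ^+ 2 <= (16 ^+ m * e) ^+ 2.
  rewrite !inE => /eqP cS /eqP cT neqST; have := tensor_test_corr S T.
  rewrite (negPf neqST) subr0 => h; rewrite -real_normK ?num_real //.
  rewrite lerXn2r ?nnegrE ?mulr_ge0 ?exprn_ge0 //.
  apply: le_trans h _; rewrite mulrC ler_wpM2r //.
  rewrite (_ : 16 = 4 ^+ 2); last by lra.
  rewrite -exprM ler_weXn2l //; first lra.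
  by rewrite mul2n -addnn -{1}cS -cT cardsU leq_subr.
have main : (\sum_(S in Q) corr S S) ^+ 2
    <= N%:R * \sum_(S in Q) \sum_(T in Q) corr S T ^+ 2.
  rewrite -(ler_pM2l (exprn_gt0 2 NR0)) -exprMn mulr_sumr mulrCA.
  under eq_bigr do rewrite -sumE.
  rewrite mulr_sumr.
  under [X in _ <= _ * X]eq_bigr do rewrite mulr_sumr.
  under [X in _ <= _ * X]eq_bigr do under eq_bigr do rewrite -exprMn -sumE.
  exact: sqr_trace_gram_le.
have tr : n%:R * (2 ^+ m - 4 ^+ m * e) <= \sum_(S in Q) corr S S.
  rewrite mulr_natl -cardQ -sumr_const; apply: ler_sum => S SQ.
  by case/andP: (diag S SQ).
rewrite -exprMn; apply: le_trans (_ : _ <= (\sum_(S in Q) corr S S) ^+ 2) _.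
  rewrite lerXn2r // nnegrE; first by rewrite mulr_ge0 ?subr_ge0.
  by apply: le_trans tr; rewrite mulr_ge0 ?subr_ge0.
apply: le_trans main _; apply: ler_wpM2l => //.
have -> : n%:R * (2 ^+ m + 4 ^+ m * e) ^+ 2 + n%:R ^+ 2 * (16 ^+ m * e) ^+ 2
    = \sum_(S in Q) ((2 ^+ m + 4 ^+ m * e) ^+ 2 + n%:R * (16 ^+ m * e) ^+ 2).
  by rewrite sumr_const cardQ -[RHS]mulr_natl; ring.
apply: ler_sum => S SQ; rewrite (bigD1 S) //=; apply: lerD.
  case/andP: (diag S SQ) => lo hi; rewrite lerXn2r // nnegrE.
    by apply: le_trans lo; rewrite subr_ge0.
  by rewrite addr_ge0 ?mulr_ge0 ?exprn_ge0.
(* The [n - 1] off-diagonal terms are counted as [n], with a zero term at [T = S]. *)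
rewrite mulr_natl -cardQ -sumr_const big_mkcondr /=.
apply: ler_sum => T TQ; case: ifP => [neq|_]; last exact: sqr_ge0.
by rewrite offdiag // eq_sym.
Qed.

End TestBoxes.

(** * Elementary estimates for the regular grid *)

Lemma sumr_below_bounds (R : realFieldType) (k : nat) (z : R) : 0 <= z <= k%:R ->
  z <= \sum_(i < k) (i%:R < z)%R%:R <= z + 1.
Proof.
move=> /andP[z0 zk].
(* Taking minima with [k] removes the hypothesis [z <= k], so that induction on [k] goes through. *)
suff : Num.min z k%:R <= \sum_(i < k) (i%:R < z)%R%:R <= Num.min (z + 1) k%:R.
  by rewrite (min_l zk) le_min => /andP[-> /andP[-> _]].
elim: k {zk} => [|k IH].
  by rewrite big_ord0 ge_min le_min lexx orbT addr_ge0.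
rewrite big_ord_recr /= -natr1; move: IH; set s := \sum_(_ < _) _.
rewrite !ge_min !le_min; case: ltP => zk /=; rewrite ?mulr1n ?mulr0n.
  by move=> /andP[lo /andP[_ hi]]; apply/andP; split; [apply/orP; lra|lra].
by move=> /andP[/orP lo /andP[h1 h2]]; apply/andP; split; [apply/orP; lra|lra].
Qed.

(** Telescoping: the factors are exchanged one at a time. *)
Lemma norm_prodB_le (R : realDomainType) (I : Type) (r : seq I) (a b : I -> R) :
  (forall i, 0 <= a i <= 1) -> (forall i, 0 <= b i <= 1) ->
  `|\prod_(i <- r) a i - \prod_(i <- r) b i| <= \sum_(i <- r) `|a i - b i|.
Proof.
move=> a01 b01.
have prod01 (c : I -> R) s : (forall i, 0 <= c i <= 1) ->
    0 <= \prod_(i <- s) c i <= 1.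
  move=> c01; apply: (big_ind (fun x => 0 <= x <= 1)) => //.
    by rewrite ler01 lexx.
  by move=> x y /andP[x0 x1] /andP[y0 y1]; rewrite mulr_ge0 // mulr_ile1.
elim: r => [|i r IH]; first by rewrite !big_nil subrr normr0.
rewrite !big_cons.
set p := \prod_(_ <- r) a _; set q := \prod_(_ <- r) b _.
rewrite (_ : _ - _ = (a i - b i) * p + b i * (p - q)); last by ring.
have /andP[p0 p1] := prod01 a r a01; have /andP[bi0 bi1] := b01 i.
apply: le_trans (ler_normD _ _) _; apply: lerD.
  by rewrite normrM (ger0_norm p0) ler_piMr.
by apply: le_trans IH; rewrite normrM (ger0_norm bi0) ler_piMl.
Qed.

(** * Supremum and infimum in the discrepancy *)

Section Discrepancy.
Context (R : realType) (d N : nat).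
Implicit Types (P : 'I_N -> 'rV[R]_d) (y : 'rV[R]_d).

Let gap P y : R := `|N%:R^-1 * (\sum_n \1_(anchored_box y) (P n)) - box_vol y|.

(** Boundedness of the family, which [sup] needs to be an upper bound. *)
Lemma gap_le1 P y : closed_cube y -> gap P y <= 1.
Proof.
move=> cy; rewrite /gap; set c := N%:R^-1 * _.
have /andP[c0 c1] : 0 <= c <= 1.
  rewrite /c mulr_ge0 ?invr_ge0 ?sumr_ge0 //=.
  (* With no points the mean is [0], since the inverse of [0] is [0]. *)
  have [N0|N0] := posnP N.
    by have -> : N%:R = 0 :> R; [rewrite N0 | rewrite invr0 mul0r].
  rewrite mulrC ler_pdivrMr ?ltr0n // mul1r.
  have -> : N%:R = \sum_(n < N) 1 :> R by rewrite sumr_const card_ord.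
  by apply: ler_sum => n _; rewrite indicE lern1 leq_b1.
have /andP[v0 v1] : 0 <= box_vol y <= 1.
  rewrite prodr_ge0 => [|j _]; last by case/andP: (cy j).
  have -> : 1 = \prod_(j < d) 1 :> R by rewrite big1.
  by apply: ler_prod => j _; exact: cy.
by rewrite ler_norml; apply/andP; split; lra.
Qed.

Lemma star_discrepancy_ge P y : closed_cube y -> gap P y <= star_discrepancy P.
Proof.
move=> cy; apply: ub_le_sup; last by exists y.
by exists 1 => _ [z cz <-]; exact: gap_le1.
Qed.

Lemma star_discrepancy_le P (e : R) :
  (forall y, closed_cube y -> gap P y <= e) -> star_discrepancy P <= e.
Proof.
move=> h; apply: ge_sup => [|_ [z cz <-]]; last exact: h.
by exists (gap P 0); exists 0 => // j; rewrite mxE lexx ler01.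
Qed.

Lemma star_discrepancy_ge0 P : 0 <= star_discrepancy P.
Proof.
apply: le_trans (star_discrepancy_ge P 0 _); first exact: normr_ge0.
by move=> j; rewrite mxE lexx ler01.
Qed.

Lemma min_star_discrepancy_le P : (forall n, half_open_cube (P n)) ->
  min_star_discrepancy R N d <= star_discrepancy P.
Proof.
move=> cP; apply: ge_inf; last by exists P.
by exists 0 => _ [Q _ <-]; exact: star_discrepancy_ge0.
Qed.

(** The infimum is only approached, at the price of a slack [t]. *)
Lemma min_star_discrepancy_approx (e t : R) :
  min_star_discrepancy R N d <= e -> 0 < t ->
  exists2 P, (forall n, half_open_cube (P n)) &
    forall y, closed_cube y -> gap P y <= e + t.
Proof.
move=> le_e t0.
have [|_ [P cP <-] lt_t] := @inf_adherent R
    [set star_discrepancy P | P in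
       [set P : 'I_N -> 'rV[R]_d | forall n, half_open_cube (P n)]]%classic t t0.
- split; last by exists 0 => _ [Q _ <-]; exact: star_discrepancy_ge0.
  pose Z : 'I_N -> 'rV[R]_d := fun=> 0.
  exists (star_discrepancy Z); exists Z => // n j.
  by rewrite mxE lexx ltr01.
exists P => // y cy; apply: le_trans (star_discrepancy_ge P y cy) _.
by apply/ltW/(lt_le_trans lt_t); rewrite lerD2r.
Qed.

End Discrepancy.

(** * Attainment of the inverse through regular grids *)

(** For the [k ^ d] points with coordinates [i / k], the empirical measure of a box is the product
    of the [c j], each within [1 / k] of [y 0 j]. *)
Lemma grid_star_discrepancy (R : realType) (d k : nat) : (0 < k)%N ->
  min_star_discrepancy R #|{ffun 'I_d -> 'I_k}| d <= d%:R / k%:R.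
Proof.
move=> k0; have kR0 : (0 : R) < k%:R by rewrite ltr0n.
pose pt (f : {ffun 'I_d -> 'I_k}) : 'rV[R]_d := \row_j ((f j)%:R / k%:R).
pose Q (n : 'I_#|{ffun 'I_d -> 'I_k}|) := pt (enum_val n).
have ptP f : half_open_cube (pt f).
  by move=> j; rewrite mxE divr_ge0 //= ltr_pdivrMr // mul1r ltr_nat.
apply: le_trans (min_star_discrepancy_le _ _ _ Q _) _ => [n|]; first exact: ptP.
apply: star_discrepancy_le => y cy.
pose c j := k%:R^-1 * \sum_(i < k) (i%:R < k%:R * y 0 j)%R%:R : R.
have c_near j : y 0 j <= c j <= y 0 j + k%:R^-1.
  have /andP[y0 y1] := cy j.
  have /sumr_below_bounds/andP[lo hi] : 0 <= k%:R * y 0 j <= k%:R.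
    by rewrite mulr_ge0 //= ler_piMr.
  rewrite /c (mulrC k%:R^-1) ler_pdivlMr // (mulrC (y 0 j)) lo /=.
  by rewrite ler_pdivrMr // mulrDl mulVf ?gt_eqF // (mulrC (y 0 j)).
have c01 j : 0 <= c j <= 1.
  have /andP[y0 _] := cy j; have /andP[lo _] := c_near j.
  rewrite (le_trans y0 lo) /= /c mulrC ler_pdivrMr // mul1r.
  have {2}-> : k%:R = \sum_(i < k) 1 :> R by rewrite sumr_const card_ord.
  by apply: ler_sum => i _; rewrite lern1 leq_b1.
have -> : #|{ffun 'I_d -> 'I_k}|%:R^-1 *
    (\sum_n \1_(anchored_box y) (Q n)) = \prod_j c j.
  have -> : \sum_n \1_(anchored_box y) (Q n) =
      \sum_f \1_(anchored_box y) (pt f) :> R.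
    rewrite [RHS](reindex_onto enum_val enum_rank) => [|f _]; last exact: enum_rankK.
    by apply: eq_bigl => i; rewrite enum_valK eqxx.
  rewrite card_ffun !card_ord natrX -exprVn.
  rewrite big_split /= prodr_const card_ord; congr (_ * _).
  rewrite bigA_distr_bigA; apply: eq_bigr => f _; rewrite indicE.
  have [h|h] := boolP (pt f \in anchored_box y).
    move: h; rewrite inE => h; rewrite big1 // => j _.
    by have /andP[_] := h j; rewrite mxE ltr_pdivrMr // mulrC => ->.
  apply/esym/eqP; apply: contraNT h => h; rewrite inE => j.
  have /andP[-> _] /= := ptP f j; rewrite mxE ltr_pdivrMr // mulrC.
  by move/prodf_neq0 : h => /(_ j isT); case: (_ < _) => //=; rewrite eqxx.
apply: le_trans (norm_prodB_le _ _ _ _ _ c01 cy) _.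
have -> : d%:R / k%:R = \sum_(j < d) k%:R^-1 :> R.
  by rewrite sumr_const card_ord mulr_natl.
apply: ler_sum => j _; have /andP[lo hi] := c_near j.
by rewrite ger0_norm ?subr_ge0 // lerBlDl.
Qed.

Lemma inverse_star_discrepancyP (R : realType) (d : nat) (e : R) : 0 < e ->
  (0 < inverse_star_discrepancy d e)%N /\
  min_star_discrepancy R (inverse_star_discrepancy d e) d <= e.
Proof.
move=> e0; rewrite /inverse_star_discrepancy.
set S := [set N | _]%classic; suff /xgetPex - /(_ 0%N)[] : exists n, is_least S n.
  by [].
have exS : exists N, `[< S N >].
  (* This [k] exceeds [d / e], so the grid has discrepancy at most [d / k <= e]. *)
  pose k := (Num.truncn (d%:R / e)).+1.
  exists #|{ffun 'I_d -> 'I_k}|; apply/asboolP; split.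
    by rewrite card_ffun !card_ord expn_gt0.
  apply: le_trans (grid_star_discrepancy _ _ _ _) _ => //.
  rewrite ler_pdivrMr ?ltr0n // mulrC -ler_pdivrMr //; apply: ltW.
  exact: truncnS_gt.
exists (ex_minn exS); case: ex_minnP => n /asboolP Sn least; split => // j Sj.
exact/least/asboolP.
Qed.

(** * Lower bound on the number of points *)

(** Lets a slack tend to [0]: were [c0] negative, the value at the minimum of [t0], [1] and
    [- c0 / (2 K)] would be at most [c0 / 2]. *)
Lemma quadratic_ge0_at0 (R : realFieldType) (c0 c1 c2 t0 : R) : 0 < t0 ->
  (forall t, 0 < t <= t0 -> 0 <= c0 + c1 * t + c2 * t ^+ 2) -> 0 <= c0.
Proof.
move=> t0_gt0 h; rewrite leNgt; apply/negP => c0_lt0.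
pose K := `|c1| + `|c2| + 1.
have K0 : 0 < K by rewrite ltr_wpDl // addr_ge0.
pose t := Num.min (Num.min t0 1) (- c0 / (2 * K)).
have t_gt0 : 0 < t by rewrite !lt_min t0_gt0 ltr01 divr_gt0 ?oppr_gt0 ?mulr_gt0.
have [tt0 t1 tK] : [/\ t <= t0, t <= 1 & t <= - c0 / (2 * K)].
  by split; rewrite !ge_min lexx ?orbT.
have {}tK : K * t <= - c0 / 2.
  move: tK; rewrite ler_pdivlMr ?mulr_gt0 //; lra.
have := h t; rewrite t_gt0 tt0 => /(_ isT).
have c1t : c1 * t <= `|c1| * t by rewrite ler_wpM2r ?(ltW t_gt0) ?ler_norm.
have c2t : c2 * t ^+ 2 <= `|c2| * t.
  apply: le_trans (_ : `|c2| * t ^+ 2 <= _).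
    by rewrite ler_wpM2r ?sqr_ge0 ?ler_norm.
  by rewrite ler_wpM2l // expr2 ler_piMr // ltW.
by move: tK; rewrite /K; lra.
Qed.

(** After multiplication by [m!] it holds factor by factor: [d (m - i) <= m (d - i)]. *)
Lemma expn_le_bin (d m : nat) : (m <= d)%N -> (d ^ m <= m ^ m * 'C(d, m))%N.
Proof.
move=> md; rewrite -(leq_pmul2r (fact_gt0 m)) -mulnA bin_ffact -ffactnn.
have expE x : (x ^ m = \prod_(i < m) x)%N by rewrite prod_nat_const card_ord.
rewrite !ffact_prod !expE -!big_split /=.
apply: leq_prod => i _; rewrite !mulnBr (mulnC m) leq_sub2l //.
by rewrite leq_mul2r md orbT.
Qed.

(** With [v = 2 ^ m e <= 1/2] and [X = 64 ^ m e ^ 2], the binomial inequality reads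
    [n (1 - v)^2 <= N ((1 + v)^2 + n X)]. The left side is at least [n / 4]; on the right
    [(1 + v)^2 <= 9/4 <= n X], so [n / 4 <= 2 N n X]. *)
Lemma points_lower_bound (R : realType) (d N m : nat) (e : R) : (0 < N)%N ->
  0 < e <= 2 ^- m.+1 -> 9 <= 4 * 'C(d, m)%:R * 64 ^+ m * e ^+ 2 ->
  min_star_discrepancy R N d <= e -> (8 * 64 ^+ m * e ^+ 2)^-1 <= N%:R.
Proof.
move=> N0 /andP[e0 em]; set n := 'C(d, m)%:R => hn hN.
have p4 : 4 ^+ m = 2 ^+ m * 2 ^+ m :> R by rewrite -exprMn; congr (_ ^+ _); lra.
have p16 : 16 ^+ m = 2 ^+ m * 2 ^+ m * 2 ^+ m * 2 ^+ m :> R.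
  by rewrite -!exprMn; congr (_ ^+ _); lra.
have p64 : 64 ^+ m = 2 ^+ m * 2 ^+ m * 2 ^+ m * 2 ^+ m * 2 ^+ m * 2 ^+ m :> R.
  by rewrite -!exprMn; congr (_ ^+ _); lra.
move: em hn; rewrite exprS p64; set u := 2 ^+ m in p4 p16 p64 *.
have u0 : 0 < u by rewrite exprn_gt0.
move=> em hn.
have {}em : 2 * (u * e) <= 1.
  by move: em; rewrite -[_^-1]mul1r ler_pdivlMr ?mulr_gt0 // [e * _]mulrC mulrA.
pose g t := N%:R * (n * (u + u * u * (e + t)) ^+ 2
          + n ^+ 2 * (u * u * u * u * (e + t)) ^+ 2)
   - n ^+ 2 * (u - u * u * (e + t)) ^+ 2.
have main : 0 <= g 0.
  pose c1 := N%:R * (n * (2 * (u + u * u * e) * (u * u))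
     + n ^+ 2 * (u * u * u * u) ^+ 2 * (2 * e))
     + n ^+ 2 * (2 * (u - u * u * e) * (u * u)).
  pose c2 := N%:R * (n * (u * u) ^+ 2 + n ^+ 2 * (u * u * u * u) ^+ 2)
     - n ^+ 2 * (u * u) ^+ 2.
  (* Slacks up to [e] are admissible: [u (e + t) <= 2 u e <= 1]. *)
  apply: (@quadratic_ge0_at0 _ (g 0) c1 c2 e e0) => t /andP[t0 te].
  have -> : g 0 + c1 * t + c2 * t ^+ 2 = g t by rewrite /g /c1 /c2; ring.
  have [P cP hP] := min_star_discrepancy_approx _ _ _ _ _ hN t0.
  have := binomial_points_ineq _ _ _ _ _ cP hP m N0.
  rewrite p4 p16 -/u -/n subr_ge0; apply.
  rewrite -mulrA ler_piMr ?(ltW u0) //.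
  have : u * t <= u * e by rewrite ler_pM2l.
  by lra.
move: main; rewrite /g addr0 subr_ge0 => main.
set v := u * e in em.
have v0 : 0 < v by rewrite mulr_gt0.
have n0 : 0 < n.
  rewrite lt_neqAle ler0n andbT; apply/eqP => n_eq; move: hn; rewrite -n_eq; lra.
have NR0 : (0 : R) < N%:R by rewrite ltr0n.
pose w := u * u * v; pose X := w ^+ 2.
have {}main : n * (1 - v) ^+ 2 <= N%:R * ((1 + v) ^+ 2 + n * X).
  rewrite -(ler_pM2l (_ : 0 < n * u ^+ 2)) ?mulr_gt0 //.
  rewrite (_ : n * u ^+ 2 * _ = n ^+ 2 * (u - u * u * e) ^+ 2); last first.
    by rewrite /v; ring.
  by apply: le_trans main _; rewrite le_eqVlt /X /w /v; apply/orP; left; apply/eqP; ring.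
have eX : u * u * u * u * u * u * e ^+ 2 = X by rewrite /X /w /v; ring.
have {}hn : 9 <= 4 * n * X by rewrite -eX mulrA.
have X0 : 0 < X by rewrite exprn_gt0 // mulr_gt0 // mulr_gt0.
rewrite -mulrA eX -div1r.
rewrite ler_pdivrMr ?mulr_gt0 //.
have lo : n / 4 <= n * (1 - v) ^+ 2.
  rewrite ler_pM2l // (_ : 4^-1 = (2^-1) ^+ 2); last by lra.
  by rewrite lerXn2r ?nnegrE; lra.
have hi : (1 + v) ^+ 2 + n * X <= 2 * n * X.
  have : (1 + v) ^+ 2 <= (3 / 2) ^+ 2 by rewrite lerXn2r ?nnegrE; lra.
  by lra.
have fin : n / 4 <= n / 4 * (N%:R * (8 * X)).
  rewrite (_ : n / 4 * _ = N%:R * (2 * n * X)); last by field.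
  by apply: le_trans lo _; apply: le_trans main _; rewrite ler_wpM2l.
by move: fin; rewrite -{1}[n / 4]mulr1 ler_pM2l // divr_gt0.
Qed.

(** * Use of the bounds on [eps] and [d] *)

Theorem theorem1p1 (R : realType) (alpha A B : R)
    (halpha : 0 < alpha < 1) (hA : 0 < A) (hAB : A <= B)
    (m : nat) (hm : 2 / alpha < m%:R)
    (eps : R) (heps : 0 < eps <= eps_threshold alpha A m)
    (d : nat) (hd : A * eps `^ (- alpha) <= d%:R <= B * eps `^ (- alpha)) :
  (8 * B * 64 ^+ m)^-1 * d%:R * eps `^ (- (2 - alpha))
    <= (inverse_star_discrepancy d eps)%:R.
Proof.
have [a0 _] := andP halpha; have [e0 et] := andP heps; have [dlo dhi] := andP hd.
have m0 : 0 < m%:R :> R by apply: lt_trans hm; rewrite divr_gt0.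
have B0 : 0 < B by exact: lt_le_trans hAB.
have gt0_m : (0 < m)%N by rewrite -(ltr0n R).
move: et; rewrite /eps_threshold !le_min => /and3P[em eC eA].
have powK x r : 0 < r -> 0 <= x -> eps <= x `^ r^-1 -> eps `^ r <= x.
  move=> r0 x0 h; have {1}-> : x = (x `^ r^-1) `^ r.
    by rewrite -powRrM mulVf ?gt_eqF // powRr1.
  by rewrite ge0_ler_powR ?nnegrE ?powR_ge0 // ltW.
have [N0 DN] := inverse_star_discrepancyP R d eps e0.
have ea0 : 0 < eps `^ alpha by exact: powR_gt0.
(* The third term of the threshold gives [m <= A eps ^ (- alpha) <= d]. *)
have md : (m <= d)%N.
  rewrite -(ler_nat R); apply: le_trans dlo.
  rewrite powRN ler_pdivlMr // mulrC -ler_pdivlMr //.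
  by apply: powK => //; rewrite divr_ge0 // ltW.
have C0 : 0 < C_const R m by rewrite mulr_gt0 ?divr_gt0 ?powR_gt0.
(* Second term of the threshold; [alpha - 2 / m] is positive because [m > 2 / alpha]. *)
have Cd : C_const R m * eps `^ (- (2 / m%:R)) <= d%:R.
  apply: le_trans dlo; rewrite [in leRHS]powRN ler_pdivlMr //.
  rewrite -mulrA mulrC -ler_pdivlMr // mulrC -powRD; last first.
    by rewrite (gt_eqF e0) implybT.
  apply: powK => //; last by rewrite divr_ge0 // ltW.
  by rewrite subr_gt0 ltr_pdivrMr // mulrC -ltr_pdivrMr.
have binom_large : 9 <= 4 * 'C(d, m)%:R * 64 ^+ m * eps ^+ 2.
  have : (C_const R m * eps `^ (- (2 / m%:R))) ^+ m <= d%:R ^+ m.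
    by rewrite lerXn2r ?nnegrE ?mulr_ge0 ?powR_ge0 // ltW.
  (* [C_const] is calibrated so that its [m]-th power turns [C(d, m) >= (d / m) ^ m] into
     [C(d, m) >= 9/4 / (64 ^ m eps ^ 2)]. *)
  have -> : (C_const R m * eps `^ (- (2 / m%:R))) ^+ m =
      m%:R ^+ m * (9 / 4 / (64 ^+ m * eps ^+ 2)).
    have powm x y : (x `^ y) ^+ m = x `^ (y * m%:R) :> R.
      by rewrite -powR_mulrn ?powR_ge0 // -powRrM.
    rewrite /C_const !exprMn !powm mulVf ?gt_eqF // powRr1; last by lra.
    rewrite mulNr divfK ?gt_eqF // powRN powR_mulrn ?(ltW e0) //.
    rewrite exprVn [(64 ^+ m * _)^-1]invfM.
    by move: (64 ^+ m)^-1 (eps ^+ 2)^-1 => u v; ring.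
  move=> /le_trans /(_ (_ : _ <= m%:R ^+ m * 'C(d, m)%:R)) h.
  have : m%:R ^+ m * (9 / 4 / (64 ^+ m * eps ^+ 2)) <= m%:R ^+ m * 'C(d, m)%:R.
    by apply: h; rewrite -!natrX -natrM ler_nat expn_le_bin.
  rewrite ler_pM2l ?exprn_gt0 // ler_pdivrMr ?mulr_gt0 ?exprn_gt0 //.
  lra.
apply: le_trans (points_lower_bound _ _ _ m eps N0 _ binom_large DN); last first.
  by rewrite e0.
have -> : eps `^ (- (2 - alpha)) = eps `^ alpha / eps ^+ 2.
  by rewrite opprB powRD ?(gt_eqF e0) ?implybT // powRN powR_mulrn // ltW.
(* The factor [d eps ^ alpha / B <= 1] brings in the linear dependence on [d]. *)
have da : d%:R * eps `^ alpha <= B.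
  by move: dhi; rewrite powRN ler_pdivlMr.
rewrite (_ : _ * _ * _ = (8 * 64 ^+ m * eps ^+ 2)^-1 * (d%:R * eps `^ alpha / B)).
  by rewrite ler_piMr ?invr_ge0 ?mulr_ge0 ?exprn_ge0 ?(ltW e0) // ler_pdivrMr ?mul1r.
by rewrite !invfM; ring.
Qed.
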